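(* Let $A(t)=\alpha t^2+\beta$ with $\alpha\in\mathbb Q^*$, $\beta\in\mathbb Q$. Write $\beta=b/d$ with $b\in\mathbb Z$, $d\in\mathbb Z_{>0}$, $(b,d)=1$. Let $s\in\mathbb Z\setminus\{0\}$ be the squarefree integer representing the square class of $d\alpha$, so $d\alpha\in s\,\mathbb Q^{*2}$. Then $$A(\mathbb Q)\cap\mathbb Z\neq\varnothing$$ (i.e. the associated quadratic source is active for ordinary-integer inputs) if and only if the congruence $$s z^2\equiv -b\pmod d$$ has a solution $z\in\mathbb Z$. Consequently, for $g\in\mathbb Q[Y]$ nonconstant, the pairs $(f,g)$ with $f\in\mathbb Q[X]$ for which $C_{f,g}$ has a non-graph $\mathbb Q$-rational one-infinity component with $d_X=2$ that is active for ordinary integers are precisely the pairs $$\left(G\left(\frac{X-\beta}{\alpha}E\left(\frac{X-\beta}{\alpha}\right)^2\right),\ G((Y-c)^2)\right),$$ where $\alpha\in\mathbb Q^*$, $\beta,c\in\mathbb Q$, $E\in\mathbb Q[U]\setminus\{0\}$, $G\in\mathbb Q[Z]\setminus\mathbb Q$, $g(Y)=G((Y-c)^2)$, and, writing $\beta=b/d$ with $b\in\mathbb Z$, $d\in\mathbb Z_{>0}$, $(b,d)=1$, and $d\alpha\in s\,\mathbb Q^{*2}$ with $s\in\mathbb Z\setminus\{0\}$ squarefree, the congruence $s z^2\equiv -b\pmod d$ has a solution $z\in\mathbb Z$.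
   Context: $C_{f,g}=(f(X)-g(Y)=0)_{\mathrm{red}}\subset\mathbb A^2_{\mathbb Q}$. A $\mathbb Q$-rational one-infinity component is a geometrically integral component $C$ over $\mathbb Q$ whose smooth projective normalization $\widetilde C$ is $\mathbb P^1_{\mathbb Q}$ and such that $\widetilde C$ minus the affine normalization $C^\nu$ is one geometric point. Then $C^\nu\cong\mathbb A^1$ and, with a coordinate $t$, $X=A_C(t)$ with $A_C\in\mathbb Q[t]$; $d_X(C)=[\mathbb Q(C):\mathbb Q(X)]=\deg A_C$. When $d_X(C)=2$, $t$ can be chosen with $A_C(t)=\alpha t^2+\beta$. The component is active for ordinary integers if $A_C(\mathbb Q)\cap\mathbb Z\ne\varnothing$. A component is a graph component if it is $Y=h(X)$ with $h\in\mathbb Q[X]$, $f=g\circ h$; otherwise non-graph. *)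

(* Defs.v *)
From HB Require Import structures.
From mathcomp Require Import all_boot all_order all_algebra all_field.

Set Implicit Arguments.
Unset Strict Implicit.
Unset Printing Implicit Defensive.

Import GRing.Theory.
Local Open Scope ring_scope.

(* A bivariate polynomial u(X, Y) over R is an element of {poly {poly R}}, with
   the conventions of polyXY: 'X (the outer indeterminate) is X and
   'Y := 'X%:P (the inner one) is Y.  Thus f(X) is f^:P and g(Y) is g%:P. *)

Definition divides (R : nzRingType) (p q : R) : Prop := exists w, q = w * p.

(* The quotient ring R / (p) is an integral domain, and p != 0: for R a
   bivariate polynomial ring, p = 0 is an integral plane curve. *)
Definition prime_element (R : comUnitRingType) (p : R) : Prop :=
  [/\ p != 0, p \isn't a GRing.unit
    & forall a b : R, divides p (a * b) -> divides p a \/ divides p b].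

Definition curve_eqn (f g : {poly rat}) : {poly {poly rat}} := f^:P - g%:P.

(* The irreducible components of (f(X) - g(Y) = 0)_red are the curves P = 0,
   for P a prime divisor of f(X) - g(Y). *)
Definition is_component (f g : {poly rat}) (P : {poly {poly rat}}) : Prop :=
  prime_element P /\ divides P (curve_eqn f g).

(* The base change of P = 0 to algC, an algebraic closure of rat,
   is integral. *)
Definition geom_integral (P : {poly {poly rat}}) : Prop :=
  prime_element (map_poly (map_poly (ratr : rat -> algC)) P).

(* phi identifies K with the function field Q(C) of C : P = 0, that is, with
   the field of fractions of Q[X, Y] / (P); phi 'X and phi 'Y are
   the coordinate functions on C. *)
Definition is_function_field (P : {poly {poly rat}}) (K : fieldType)
    (phi : {rmorphism {poly {poly rat}} -> K}) : Prop :=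
  (forall u, phi u = 0 <-> divides P u) /\
  (forall z : K, exists u v, phi v != 0 /\ z = phi u / phi v).

Definition subfield_QX (K : fieldType)
    (phi : {rmorphism {poly {poly rat}} -> K}) (z : K) : Prop :=
  exists u v : {poly rat}, phi v^:P != 0 /\ z = phi u^:P / phi v^:P.

(* [K : L] = n, witnessed by a basis; L is meant to be a subfield of K. *)
Definition has_degree_over (K : fieldType) (L : K -> Prop) (n : nat) : Prop :=
  exists e : 'I_n -> K, forall z : K,
    exists! c : {ffun 'I_n -> K},
      (forall i, L (c i)) /\ z = \sum_(i < n) c i * e i.

(* d_X(C) = [Q(C) : Q(X)] = n *)
Definition dX_eq (P : {poly {poly rat}}) (n : nat) : Prop :=
  exists (K : fieldType) (phi : {rmorphism {poly {poly rat}} -> K}),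
    is_function_field P phi /\ has_degree_over (subfield_QX phi) n.

(* The function field Q(t) of the projective line over Q. *)
Definition Qt : fieldType := {fraction {poly rat}}.

Definition to_Qt (p : {poly rat}) : Qt := @FracField.tofrac {poly rat} p.

(* Geometric points of the projective line: Some a is t = a, None is the
   point t = oo.  The rational function z belongs to the local ring at p. *)
Definition regular_at (z : Qt) (p : option algC) : Prop :=
  exists n d : {poly rat},
    z = to_Qt n / to_Qt d /\
    match p with
    | Some a => (map_poly (ratr : rat -> algC) d).[a] != 0
    | None => d != 0 /\ (size n <= size d)%N
    end.

(* A smooth projective curve is determined by its function field, so the smooth
   projective normalization of C is isomorphic to the projective line exactly
   when Q(C) can be identified with Q(t), and phi is such an identification.
   The affine normalization consists of the points at which the coordinate
   functions are both regular. *)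
Definition at_infinity (phi : {rmorphism {poly {poly rat}} -> Qt})
    (p : option algC) : Prop :=
  ~ (regular_at (phi 'X) p /\ regular_at (phi 'Y) p).

Definition rational_one_infinity (P : {poly {poly rat}}) : Prop :=
  geom_integral P /\
  exists phi : {rmorphism {poly {poly rat}} -> Qt},
    is_function_field P phi /\ exists! p : option algC, at_infinity phi p.

(* t is a coordinate on the affine normalization, identified with the affine
   line: the only point at infinity is t = oo. *)
Definition affine_coordinate (P : {poly {poly rat}})
    (phi : {rmorphism {poly {poly rat}} -> Qt}) : Prop :=
  is_function_field P phi /\ forall p, at_infinity phi p <-> p = None.

Definition has_integer_value (A : {poly rat}) : Prop :=
  exists (t : rat) (n : int), A.[t] = n%:~R.

(* A is A_C, i.e. X = A(t).  The set A_C(Q) does not depend on the choice of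
   the coordinate t. *)
Definition active_for_integers (P : {poly {poly rat}}) : Prop :=
  exists (phi : {rmorphism {poly {poly rat}} -> Qt}) (A : {poly rat}),
    [/\ affine_coordinate P phi, phi 'X = to_Qt A & has_integer_value A].

(* The curves P = 0 and Y = h(X) coincide, and f = g o h. *)
Definition graph_component (f g : {poly rat}) (P : {poly {poly rat}}) : Prop :=
  exists h : {poly rat},
    [/\ divides P ('Y - h^:P), divides ('Y - h^:P) P & f = g \Po h].

Definition squarefreez (s : int) : Prop :=
  s <> 0 /\ forall k : int, (k ^+ 2 %| s)%Z -> `|k| = 1.

Definition in_square_class (x : rat) (s : int) : Prop :=
  exists q : rat, q != 0 /\ x = s%:~R * q ^+ 2.

(* beta = b / d in lowest terms, and s is the squarefree integer in the square
   class of d alpha. *)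
Definition quadratic_data (alpha beta : rat) (b d s : int) : Prop :=
  [/\ 0 < d, coprimez b d, beta = b%:~R / d%:~R, squarefreez s
    & in_square_class (d%:~R * alpha) s].

(* Main.v *)
(* Write s q^2 = d alpha.  Then alpha t^2 + b / d = n means s (q t)^2 = n d - b,
   and q t is an integer because s is squarefree; this is the arithmetic criterion.

   For the classification, a component with d_X = 2 is parametrized, after
   completing the square, by X = alpha t^2 + beta, Y = B(t), so f(X(t)) = g(B(t))
   is even in t.  Comparing B(t) and B(-t) through g forces B - c to be even or
   odd for some constant c; the even case is a graph.  Hence B = c + t E(t^2), and
   evenness of g(B(t)) in turn makes g a polynomial in (Y - c)^2.  Conversely
   the kernel of X |-> alpha t^2 + beta, Y |-> c + t E(t^2) is generated by
   U E(U)^2 - (Y - c)^2, with U = (X - beta) / alpha, over any field. *)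

Require Import Defs.
From HB Require Import structures.
From mathcomp Require Import all_boot all_order all_algebra all_field.
From mathcomp Require Import ring.

Set Implicit Arguments.
Unset Strict Implicit.
Unset Printing Implicit Defensive.

Import Order.TTheory GRing.Theory Num.Theory.
Local Open Scope ring_scope.
Local Open Scope quotient_scope.

(** * Integral values of a quadratic polynomial *)

(** In lowest terms [w = u / v] the equation reads [s u^2 = N v^2]. As [v^2] is prime to [u^2], it
    divides [s], and squarefreeness forces [v = 1]. *)
Lemma squarefree_mul_sqr_int (s N : int) (w : rat) :
  squarefreez s -> s%:~R * w ^+ 2 = N%:~R -> exists z : int, w = z%:~R.
Proof.
move=> [_ sqf_s] swN.
have den_neq0 : (denq w)%:~R != 0 :> rat by rewrite intr_eq0 denq_neq0.
have eqN : s * numq w ^+ 2 = N * denq w ^+ 2.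
  apply/eqP; rewrite -(eqr_int rat).
  have numE : (numq w)%:~R = w * (denq w)%:~R by rewrite -{2}[w]divq_num_den divfK.
  rewrite rmorphM rmorphXn [X in _ == X]rmorphM rmorphXn /= numE -swN.
  by rewrite exprMn mulrA.
have dvd_s : (denq w ^+ 2 %| s)%Z.
  have cop : coprimez (denq w ^+ 2) (numq w ^+ 2).
    by rewrite coprimezXl // coprimezXr // coprimez_sym coprimezE coprime_num_den.
  by rewrite -(Gauss_dvdzl s cop) eqN dvdz_mull.
have den1 := sqf_s _ dvd_s.
exists (numq w); rewrite -{1}[w]divq_num_den.
by rewrite -[denq w]absz_denq -abszE in den1 *; case: den1 => ->; rewrite divr1.
Qed.

Lemma has_integer_value_quadratic (alpha beta : rat) (b d s : int) :
  quadratic_data alpha beta b d s ->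
  (has_integer_value (alpha *: 'X^2 + beta%:P) <->
   exists z : int, (s * z ^+ 2 = - b %[mod d])%Z).
Proof.
move=> [d_gt0 _ -> sqf_s [q [q_neq0 dalpha]]].
have d_neq0 : d%:~R != 0 :> rat by rewrite intr_eq0 lt0r_neq0.
have evalE t : (alpha *: 'X^2 + (b%:~R / d%:~R)%:P).[t]
    = (s%:~R * (q * t) ^+ 2 + b%:~R) / d%:~R.
  have -> : alpha = s%:~R * q ^+ 2 / d%:~R by rewrite -dalpha mulrC mulKf.
  by rewrite hornerD hornerZ hornerXn hornerC; field.
split=> [[t [n]]|[z /eqP]].
  rewrite evalE => tn.
  have : s%:~R * (q * t) ^+ 2 = (n * d - b)%:~R.
    by rewrite rmorphB rmorphM /= -tn; field.
  move=> eqt; have [z qt] := squarefree_mul_sqr_int sqf_s eqt.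
  exists z; apply/eqP; rewrite eqz_mod_dvd; apply/dvdzP; exists n.
  apply/eqP; rewrite -(eqr_int rat) opprK rmorphD rmorphM rmorphXn /= -qt eqt.
  by apply/eqP; rewrite rmorphB /= subrK.
rewrite eqz_mod_dvd opprK => /dvdzP[n eqn].
exists (z%:~R / q), n; rewrite evalE [q * _]mulrC divfK //.
by rewrite -rmorphXn -rmorphM -rmorphD /= eqn rmorphM /= mulfK.
Qed.

Lemma squarefree_part_int (N : int) : N != 0 ->
  exists s k : int, [/\ squarefreez s, k != 0 & N = s * k ^+ 2].
Proof.
have [n] := ubnP `|N|%N; elim: n N => // n IHn N le_Nn N_neq0.
(* Any [k > 1] with [k^2] dividing [N] is at most [|N|], so the search is finite. If one exists, the
   induction applies to [N / k^2]; otherwise [N] is itself squarefree. *)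
have [/existsP[k0 /andP[k_gt1 dvd_k]]|/existsPn sqf] :=
    boolP [exists k : 'I_`|N|.+1, (1 < k)%N && (k ^ 2 %| `|N|)%N]; last first.
  exists N, 1; split; rewrite ?expr1n ?mulr1 //; split=> [/eqP|k dvd_k].
    by rewrite (negPf N_neq0).
  have dvd_k2 : (`|k| ^ 2 %| `|N|)%N by rewrite -abszX.
  have k_neq0 : k != 0.
    by apply: contraNneq N_neq0 => k0; rewrite k0 expr0n dvd0z in dvd_k.
  have le_kN : (`|k| < `|N|.+1)%N.
    rewrite ltnS (leq_trans _ (dvdn_leq _ dvd_k2)) ?absz_gt0 //.
    by rewrite leq_pmulr ?absz_gt0.
  have := sqf (Ordinal le_kN); rewrite /= dvd_k2 andbT -abszE.
  by move: k_neq0; rewrite -absz_gt0; case: `|k|%N => [|[|m]].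
have /dvdzP[M defN] : ((k0 : nat)%:Z ^+ 2 %| N)%Z by rewrite dvdzE abszX.
set k := (k0 : nat)%:Z in defN.
have [M_neq0 k_neq0] : M != 0 /\ k != 0.
  by move: N_neq0; rewrite defN mulf_eq0 expf_eq0 negb_or => /andP[].
have lt_MN : (`|M| < `|N|)%N.
  rewrite defN abszM abszX ltn_Pmulr ?absz_gt0 //.
  by rewrite /k /= (ltn_trans k_gt1) // -[X in (X < _)%N]expn1 ltn_exp2l.
have [s [j [sqf_s j_neq0 defM]]] := IHn M (leq_trans lt_MN le_Nn) M_neq0.
exists s, (j * k); split; rewrite ?mulf_neq0 //.
by rewrite exprMn mulrA -defM -defN.
Qed.

Lemma quadratic_data_exists (alpha beta : rat) : alpha != 0 ->
  exists b d s : int, quadratic_data alpha beta b d s.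
Proof.
move=> alpha_neq0; pose x := (denq beta)%:~R * alpha.
have x_neq0 : x != 0 by rewrite mulf_neq0 // intr_eq0 denq_neq0.
have den_neq0 : (denq x)%:~R != 0 :> rat by rewrite intr_eq0 denq_neq0.
(* The integer [numq x * denq x] lies in the square class of [x]: their quotient is [denq x ^ 2]. *)
have [|s [k [sqf_s k_neq0 defs]]] := @squarefree_part_int (numq x * denq x).
  by rewrite mulf_neq0 ?numq_eq0 ?denq_neq0.
exists (numq beta), (denq beta), s; split=> //.
- by rewrite coprimezE coprime_num_den.
- by rewrite divq_num_den.
exists (k%:~R / (denq x)%:~R); split.
  by rewrite mulf_neq0 ?invr_eq0 ?intr_eq0.
rewrite -/x expr_div_n mulrA -rmorphXn -rmorphM /= -defs -{1}[x]divq_num_den.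
by rewrite rmorphM /=; field.
Qed.

(** * Parametrized plane curves *)

(** The substitution [X := A(t)], [Y := B(t)]: first [B] for the inner variable in each coefficient,
    then [A] for the outer one. Its kernel is the ideal of the parametrized curve. *)
Definition curve_param (F : fieldType) (A B : {poly F}) :
    {rmorphism {poly {poly F}} -> {poly F}} :=
  horner_eval A \o map_poly (comp_poly B).

Section CurveParam.
Variables (F : fieldType) (A B : {poly F}).

Lemma curve_param_inner (p : {poly F}) : curve_param A B p%:P = p \Po B.
Proof. by rewrite /curve_param /= map_polyC /horner_eval hornerC. Qed.

Lemma curve_param_outer (p : {poly F}) : curve_param A B p^:P = p \Po A.
Proof.
rewrite /curve_param /= -map_poly_comp /horner_eval.
by congr _.[A]; apply: eq_map_poly => x /=; rewrite comp_polyC.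
Qed.

Lemma curve_paramX : curve_param A B 'X = A.
Proof. by rewrite /curve_param /= map_polyX /horner_eval hornerX. Qed.

Lemma curve_paramY : curve_param A B 'Y = B.
Proof. by rewrite curve_param_inner comp_polyX. Qed.

End CurveParam.

(** The two summands occupy coefficients of opposite parity, so they cannot cancel. *)
Lemma even_odd_poly_eq0 (R : nzRingType) (p q : {poly R}) :
  p \Po 'X^2 + (q \Po 'X^2) * 'X = 0 -> p = 0 /\ q = 0.
Proof.
move=> pq0; split; apply/polyP => i; rewrite coef0.
  have := congr1 (fun r : {poly R} => r`_(i.*2)) pq0.
  rewrite coef0 coefD coefMX !coef_comp_poly_Xn // dvdn2 odd_double /=.
  by rewrite -muln2 mulnK //; case: i => [|i] /=;
     rewrite ?muln2 ?addr0 // /dvdn modn2 /= odd_double addr0.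
have := congr1 (fun r : {poly R} => r`_(i.*2.+1)) pq0.
rewrite coef0 coefD coefMX !coef_comp_poly_Xn // !dvdn2 /= odd_double /=.
by rewrite add0r -muln2 mulnK.
Qed.

(** * The curve [U E(U)^2 = (Y - c)^2] over an arbitrary field *)

Section QuadraticCurve.
Variables (F : fieldType) (alpha beta c : F) (E : {poly F}).
Hypotheses (alpha_neq0 : alpha != 0) (E_neq0 : E != 0).

(** The coordinate [U], which becomes [t^2] along the parametrization by [quad_X] and [quad_Y]. *)
Definition quad_var : {poly F} := alpha^-1 *: ('X - beta%:P).
Definition quad_rhs : {poly F} := quad_var * (E \Po quad_var) ^+ 2.
Definition quad_eqn : {poly {poly F}} := quad_rhs^:P - (('X - c%:P) ^+ 2)%:P.
Definition quad_X : {poly F} := alpha *: 'X^2 + beta%:P.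
Definition quad_Y : {poly F} := c%:P + (E \Po 'X^2) * 'X.

Lemma quad_X_comp : quad_X = (alpha *: 'X + beta%:P) \Po 'X^2.
Proof. by rewrite comp_polyD comp_polyZ comp_polyX comp_polyC. Qed.

Lemma quad_var_comp : quad_var \Po quad_X = 'X^2.
Proof.
rewrite comp_polyZ comp_polyB comp_polyX comp_polyC addrK scalerA.
by rewrite mulVf // scale1r.
Qed.

Lemma size_affine : size (alpha *: 'X + beta%:P) = 2.
Proof.
rewrite -mul_polyC size_MXaddC polyC_eq0 (negPf alpha_neq0).
by rewrite size_polyC alpha_neq0.
Qed.

(** The first term is even in [t] and the second odd, so both vanish; [E] cancels, and composition
    with an affine polynomial of degree 1 is injective. Hence [1] and [Y - c] are independent over
    [F[X]] on the curve. *)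
Lemma quad_param_normal_eq0 (r0 r1 : {poly F}) :
  r0 \Po quad_X + (r1 \Po quad_X) * ((E \Po 'X^2) * 'X) = 0 -> r0 = 0 /\ r1 = 0.
Proof.
rewrite quad_X_comp !comp_polyA mulrA -comp_polyM => /even_odd_poly_eq0[/eqP r00 /eqP].
rewrite mulf_eq0 (negPf E_neq0) orbF => r10.
by rewrite !comp_poly2_eq0 ?size_affine // in r00 r10; split; apply/eqP.
Qed.

Lemma quad_eqn_param : curve_param quad_X quad_Y quad_eqn = 0.
Proof.
rewrite rmorphB curve_param_outer curve_param_inner /quad_rhs.
rewrite comp_polyM !rmorphXn /= -comp_polyA quad_var_comp.
rewrite comp_polyB comp_polyX comp_polyC /quad_Y.
by ring.
Qed.

(* Division by the equation, which is monic of degree 2 in 'Y - c up to sign. *)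
Lemma quad_normal_form (u : {poly {poly F}}) : exists w (r0 r1 : {poly F}),
  u = w * quad_eqn + (r0^:P + r1^:P * ('Y - c%:P%:P)).
Proof.
(* Normal forms are stable under multiplication by [Y]: with [y = Y - c], write [Y = c + y] and
   replace [y^2] by [quad_rhs - quad_eqn]. *)
have mulY w r0 r1 : (w * quad_eqn + (r0^:P + r1^:P * ('Y - c%:P%:P))) * 'Y =
    (w * 'Y - r1^:P) * quad_eqn
    + ((c%:P * r0 + r1 * quad_rhs)^:P + (r0 + c%:P * r1)^:P * ('Y - c%:P%:P)).
  have -> : (c%:P * r0 + r1 * quad_rhs)^:P
      = c%:P%:P * r0^:P + r1^:P * quad_rhs^:P.
    by rewrite rmorphD !rmorphM /= map_polyC.
  have -> : (r0 + c%:P * r1)^:P = r0^:P + c%:P%:P * r1^:P.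
    by rewrite rmorphD rmorphM /= map_polyC.
  have -> : quad_eqn = quad_rhs^:P - ('Y - c%:P%:P) ^+ 2.
    by rewrite /quad_eqn rmorphXn rmorphB.
  by ring.
elim/poly_ind: u => [|u p [w1 [r0 [r1 ->]]]].
  by exists 0, 0, 0; rewrite rmorph0 !mul0r !addr0.
(* The coefficient of a power of [X] is a polynomial in [Y], which calls for a second induction. *)
have [w2 [s0 [s1 ->]]] : exists w (r0 r1 : {poly F}),
    p%:P = w * quad_eqn + (r0^:P + r1^:P * ('Y - c%:P%:P)).
  elim/poly_ind: p => [|p a [w [s0 [s1 IHp]]]].
    by exists 0, 0, 0; rewrite !rmorph0 !mul0r !addr0.
  exists (w * 'Y - s1^:P), (c%:P * s0 + s1 * quad_rhs + a%:P), (s0 + c%:P * s1).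
  rewrite rmorphD rmorphM /= IHp mulY (rmorphD _ _ a%:P) /= map_polyC /=.
  by rewrite -!addrA; congr (_ + (_ + _)); rewrite addrC.
exists (w1 * 'X + w2), (r0 * 'X + s0), (r1 * 'X + s1).
rewrite !(rmorphD, rmorphM) /= map_polyX.
by ring.
Qed.

(** Modulo the equation only a normal form remains, and a normal form that vanishes along the
    parametrization is zero. *)
Lemma quad_eqn_kernel (u : {poly {poly F}}) :
  curve_param quad_X quad_Y u = 0 <-> divides quad_eqn u.
Proof.
split=> [|[w ->]]; last by rewrite rmorphM quad_eqn_param mulr0.
have [w [r0 [r1 ->]]] := quad_normal_form u.
rewrite rmorphD rmorphM quad_eqn_param mulr0 add0r rmorphD rmorphM rmorphB.
rewrite !curve_param_outer !curve_param_inner comp_polyX comp_polyC /quad_Y.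
rewrite [c%:P + _]addrC addrK => /quad_param_normal_eq0[-> ->].
by exists w; rewrite rmorph0 mul0r !addr0.
Qed.

Lemma quad_eqn_neq0 : quad_eqn != 0.
Proof.
(* At [X = beta], [Y = t] the coordinate [U] vanishes and the equation becomes [-(t - c)^2]. *)
apply/eqP => /(congr1 (curve_param beta%:P 'X))/eqP.
rewrite rmorph0 rmorphB curve_param_outer curve_param_inner comp_polyCr.
have -> : quad_rhs.[beta] = 0.
  by rewrite hornerM hornerZ hornerXsubC subrr mulr0 mul0r.
rewrite comp_polyXr sub0r oppr_eq0.
by rewrite expf_eq0 /= polyXsubC_eq0.
Qed.

(** The equation generates the kernel of a morphism to the domain [F[t]]. *)
Lemma quad_eqn_prime : prime_element quad_eqn.
Proof.
split.
- exact: quad_eqn_neq0.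
- apply/negP => eqn_unit.
  have := rmorph_unit (curve_param quad_X quad_Y) eqn_unit.
  by rewrite quad_eqn_param unitr0.
move=> a b /quad_eqn_kernel/eqP; rewrite rmorphM mulf_eq0.
by case/orP=> /eqP/quad_eqn_kernel; [left|right].
Qed.
End QuadraticCurve.

(** * Function fields *)

Lemma map_poly_outer (aR rR : nzRingType) (h : {rmorphism aR -> rR}) (p : {poly aR}) :
  map_poly (map_poly h) p^:P = (map_poly h p)^:P.
Proof.
by apply/polyP => i; rewrite !coef_map /= map_polyC.
Qed.

Lemma even_poly_comp (R : nzRingType) (p : {poly R}) :
  odd_poly p = 0 -> even_poly p \Po 'X^2 = p.
Proof. by move=> odd0; rewrite -{2}[p]poly_even_odd odd0 comp_poly0 mul0r addr0. Qed.

Lemma comp_polyNX_even_odd (R : comNzRingType) (p : {poly R}) :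
  p \Po (- 'X) = even_poly p \Po 'X^2 - (odd_poly p \Po 'X^2) * 'X.
Proof.
rewrite -{1}[p]poly_even_odd comp_polyD comp_polyM comp_polyX -!comp_polyA.
by rewrite rmorphXn /= comp_polyX sqrrN mulrN.
Qed.

(** The symmetry makes twice the odd part vanish, and 2 is invertible in [rat]. *)
Lemma odd_poly_eq0 (p : {poly rat}) : p \Po (- 'X) = p -> odd_poly p = 0.
Proof.
move=> /eqP; rewrite comp_polyNX_even_odd -[X in _ == X](poly_even_odd p).
rewrite (inj_eq (addrI _)) eq_sym -subr_eq0 opprK -mulr2n -scaler_nat.
rewrite scaler_eq0 /= mulf_eq0 polyX_eq0 orbF comp_poly_eq0 ?size_polyXn //.
by move/eqP.
Qed.

(** Multiplication by [X] turns an odd polynomial into an even one. *)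
Lemma even_poly_eq0 (p : {poly rat}) : p \Po (- 'X) = - p -> even_poly p = 0.
Proof.
move=> odd_p; rewrite -odd_polyMX; apply: odd_poly_eq0.
by rewrite comp_polyM comp_polyX odd_p mulrNN.
Qed.

Lemma Qt_fraction (z : Qt) :
  exists n d : {poly rat}, d != 0 /\ z = to_Qt n / to_Qt d.
Proof.
elim/quotW: z => x; exists x.1, x.2; split; first exact: denom_ratioP.
have d_neq0 : to_Qt x.2 != 0 by rewrite tofrac_eq0 denom_ratioP.
apply: (mulIf d_neq0); rewrite divfK // /to_Qt; unlock FracField.tofrac.
rewrite -[LHS]FracField.pi_mul; apply/eqmodP.
rewrite /= FracField.equivfE /FracField.mulf /= !numden_Ratio ?oner_neq0 ?mulr1
  ?denom_ratioP //.
by rewrite mulrC.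
Qed.

(** With [psi = phi] this describes the whole function field, and with [psi] the restriction of
    [phi] to polynomials in [X] it is [subfield_QX phi]; one set of closure properties serves
    both. *)
Definition quotient_in (R : nzRingType) (K : fieldType) (psi : {rmorphism R -> K})
    (x : K) : Prop :=
  exists u v : R, psi v != 0 /\ x = psi u / psi v.

Section Quotients.
Variables (R : nzRingType) (K : fieldType) (psi : {rmorphism R -> K}).
Implicit Types x y : K.

Lemma quotient_in_img (u : R) : quotient_in psi (psi u).
Proof. by exists u, 1; rewrite rmorph1 divr1 oner_neq0. Qed.

Lemma quotient_in0 : quotient_in psi 0.
Proof. by rewrite -(rmorph0 psi); apply: quotient_in_img. Qed.

Lemma quotient_in1 : quotient_in psi 1.
Proof. by rewrite -(rmorph1 psi); apply: quotient_in_img. Qed.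

Lemma quotient_inM x y :
  quotient_in psi x -> quotient_in psi y -> quotient_in psi (x * y).
Proof.
move=> [u [v [v0 ->]]] [u' [v' [v0' ->]]]; exists (u * u'), (v * v').
by rewrite !rmorphM mulf_neq0 // mulf_div.
Qed.

Lemma quotient_inB x y :
  quotient_in psi x -> quotient_in psi y -> quotient_in psi (x - y).
Proof.
move=> [u [v [v0 ->]]] [u' [v' [v0' ->]]].
exists (u * v' - u' * v), (v * v').
rewrite rmorphB !rmorphM mulf_neq0 //; split=> //.
by field; rewrite v0 v0'.
Qed.

Lemma quotient_inD x y :
  quotient_in psi x -> quotient_in psi y -> quotient_in psi (x + y).
Proof.
move=> Lx Ly; rewrite -[y]opprK -[- y]add0r.
by do 2![apply: quotient_inB => //]; apply: quotient_in0.
Qed.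

Lemma quotient_inV x : quotient_in psi x -> quotient_in psi x^-1.
Proof.
move=> [u [v [v0 ->]]]; have [u0|u0] := eqVneq (psi u) 0.
  by rewrite u0 mul0r invr0; apply: quotient_in0.
by exists v, u; rewrite invf_div.
Qed.

End Quotients.

Section SubfieldQX.
Variables (K : fieldType) (phi : {rmorphism {poly {poly rat}} -> K}).

Let psi : {rmorphism {poly rat} -> K} := phi \o map_poly polyC.

Lemma subfield_QX0 : subfield_QX phi 0.
Proof. exact: (quotient_in0 psi). Qed.

Lemma subfield_QX1 : subfield_QX phi 1.
Proof. exact: (quotient_in1 psi). Qed.

Lemma subfield_QXM (x y : K) :
  subfield_QX phi x -> subfield_QX phi y -> subfield_QX phi (x * y).
Proof. exact: (@quotient_inM _ _ psi). Qed.

Lemma subfield_QXB (x y : K) :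
  subfield_QX phi x -> subfield_QX phi y -> subfield_QX phi (x - y).
Proof. exact: (@quotient_inB _ _ psi). Qed.

End SubfieldQX.

Definition curve_frac (A B : {poly rat}) : {rmorphism {poly {poly rat}} -> Qt} :=
  @FracField.tofrac {poly rat} \o curve_param A B.

Lemma curve_fracE (A B : {poly rat}) u : curve_frac A B u = to_Qt (curve_param A B u).
Proof. by []. Qed.

Lemma to_Qt_eq0 (p : {poly rat}) : (to_Qt p == 0) = (p == 0).
Proof. exact: tofrac_eq0. Qed.

Lemma regular_at_finite (p : {poly rat}) (a : algC) : regular_at (to_Qt p) (Some a).
Proof. by exists p, 1; rewrite /to_Qt tofrac1 divr1 rmorph1 hornerC oner_neq0. Qed.

(** If [p = n / d] with [deg n <= deg d], comparing degrees in [n = p d] leaves [p] constant. *)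
Lemma regular_at_infty (p : {poly rat}) :
  regular_at (to_Qt p) None -> (size p <= 1)%N.
Proof.
move=> [n [d [pnd [d_neq0 le_nd]]]]; have [->|p_neq0] := eqVneq p 0.
  by rewrite size_poly0.
have n_eq : n = p * d.
  apply/eqP; rewrite -tofrac_eq tofracM [X in X * _]pnd divfK //.
  by rewrite tofrac_eq0.
by move: le_nd; rewrite n_eq size_mul // -subn1 leq_subLR leq_add2r.
Qed.

Lemma map_quad_eqn (aF rF : fieldType) (h : {rmorphism aF -> rF})
    (alpha beta c : aF) (E : {poly aF}) :
  map_poly (map_poly h) (quad_eqn alpha beta c E) =
  quad_eqn (h alpha) (h beta) (h c) (map_poly h E).
Proof.
rewrite /quad_eqn rmorphB /= map_poly_outer map_polyC /=.
rewrite /quad_rhs /quad_var !(rmorphM, rmorphXn, rmorphB) /= !map_comp_poly.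
by rewrite map_polyZ rmorphB /= map_polyX !map_polyC /= fmorphV.
Qed.

Lemma addf_div_mulr (K : fieldType) (u v u' v' t : K) : v != 0 -> v' != 0 ->
  u / v + u' / v' * t = (u * v' + u' * v * t) / (v * v').
Proof. by move=> v0 v0'; field; rewrite v0 v0'. Qed.

(** * The explicit curve as a component: function field, infinity, degree *)

Section QuadraticFunctionField.
Variables (alpha beta c : rat) (E : {poly rat}).
Hypotheses (alpha_neq0 : alpha != 0) (E_neq0 : E != 0).

Let P := quad_eqn alpha beta c E.
Let phi := curve_frac (quad_X alpha beta) (quad_Y c E).

(** The base change is an equation of the same shape over [algC], and such equations are prime over
    every field. *)
Lemma quad_geom_integral : geom_integral P.
Proof.
rewrite /geom_integral /P (map_quad_eqn (ratr : {rmorphism rat -> algC})).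
by apply: quad_eqn_prime; rewrite ?fmorph_eq0 ?map_poly_eq0.
Qed.

Lemma quad_function_field : is_function_field P phi.
Proof.
split=> [u|z].
  rewrite -quad_eqn_kernel // curve_fracE; split=> [/eqP|->]; last exact: rmorph0.
  by rewrite to_Qt_eq0 => /eqP.
(* The parametrization is birational, with inverse [t = (Y - c) / E(U)]. *)
have frac_t : quotient_in phi (to_Qt 'X).
  exists ('Y - c%:P%:P), (E \Po quad_var alpha beta)^:P.
  rewrite /phi !curve_fracE rmorphB curve_paramY curve_param_inner comp_polyC.
  rewrite /quad_Y [c%:P + _]addrC addrK curve_param_outer -comp_polyA quad_var_comp //.
  have EX2 : E \Po 'X^2 != 0 by rewrite comp_poly_eq0 // size_polyXn.
  split; first by rewrite to_Qt_eq0.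
  by rewrite {2}/to_Qt tofracM mulrC mulKf // tofrac_eq0.
have frac_poly p : quotient_in phi (to_Qt p).
  elim/poly_ind: p => [|p a IHp].
    by rewrite /to_Qt tofrac0; apply: quotient_in0.
  rewrite /to_Qt tofracD tofracM; apply: quotient_inD; first exact: quotient_inM.
  have -> : FracField.tofrac a%:P = phi a%:P%:P.
    by rewrite /phi curve_fracE curve_param_inner comp_polyC.
  exact: quotient_in_img.
have [n [d [_ ->]]] := Qt_fraction z.
by apply: quotient_inM => //; apply: quotient_inV.
Qed.

(** Both coordinate functions are polynomials in [t], hence regular at finite points, while [X] is
    nonconstant and so has a pole at infinity. *)
Lemma quad_affine_coordinate : affine_coordinate P phi.
Proof.
split; first exact: quad_function_field.
have phiX : phi 'X = to_Qt (quad_X alpha beta) by rewrite /phi curve_fracE curve_paramX.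
have phiY : phi 'Y = to_Qt (quad_Y c E) by rewrite /phi curve_fracE curve_paramY.
rewrite /at_infinity phiX phiY => -[a|]; split=> //.
  by case; split; apply: regular_at_finite.
move=> _ [/regular_at_infty + _].
rewrite /quad_X size_polyDl size_scale ?size_polyXn //.
by rewrite size_polyC; case: (beta != 0).
Qed.

Lemma quad_rational_one_infinity : rational_one_infinity P.
Proof.
split; first exact: quad_geom_integral.
exists phi; split; first exact: quad_function_field.
have [_ infE] := quad_affine_coordinate.
by exists None; split=> [|p]; [exact/infE | move/infE].
Qed.

Lemma quad_phi_outer (r : {poly rat}) :
  phi (r \Po quad_var alpha beta)^:P = to_Qt (r \Po 'X^2).
Proof. by rewrite /phi curve_fracE curve_param_outer -comp_polyA quad_var_comp. Qed.

Lemma quad_subfield_QX (x : Qt) : subfield_QX phi x -> exists u v : {poly rat},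
  v \Po quad_X alpha beta != 0
  /\ x = to_Qt (u \Po quad_X alpha beta) / to_Qt (v \Po quad_X alpha beta).
Proof.
move=> [u [v []]]; rewrite /phi !curve_fracE !curve_param_outer to_Qt_eq0.
by exists u, v.
Qed.

Lemma quad_independent (x y : Qt) : subfield_QX phi x -> subfield_QX phi y ->
  x + y * to_Qt 'X = 0 -> x = 0 /\ y = 0.
Proof.
move=> /quad_subfield_QX[u [v [v0 ->]]] /quad_subfield_QX[u' [v' [v0' ->]]].
rewrite addf_div_mulr ?to_Qt_eq0 // => /eqP.
rewrite mulf_eq0 invr_eq0 mulf_eq0 !to_Qt_eq0 (negPf v0) (negPf v0') !orbF.
rewrite /to_Qt -!tofracM -tofracD tofrac_eq0 -!comp_polyM => /eqP eq0.
(* After clearing denominators this is the parity argument with [E = 1], which puts [t] in the place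
   of [Y - c]. *)
have [|/eqP + /eqP] := @quad_param_normal_eq0 _ alpha beta 1 alpha_neq0
    (oner_neq0 _) (u * v') (u' * v); first by rewrite comp_polyC mul1r.
have nz w : w \Po quad_X alpha beta != 0 -> w != 0.
  by apply: contraNneq => ->; rewrite comp_poly0.
rewrite !mulf_eq0 (negPf (nz _ v0)) (negPf (nz _ v0')) !orbF => /eqP -> /eqP ->.
by rewrite comp_poly0 tofrac0 !mul0r.
Qed.

(** Since [U = t^2], the subfield [Q(X)] is [Q(t^2)], over which [1, t] is a basis of [Q(t)]. *)
Lemma quad_dX : dX_eq P 2.
Proof.
exists Qt, phi; split; first exact: quad_function_field.
exists (fun i => if i == ord0 then 1 else to_Qt 'X) => z.
have [n [d [d_neq0 ->]]] := Qt_fraction z.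
have dN_neq0 : d \Po (- 'X) != 0.
  by rewrite comp_poly_eq0 // size_polyN size_polyX.
(* Multiplying numerator and denominator by [d(-t)] makes the denominator even; the coordinates are
   then the even and odd parts of [N] over [D]. *)
set D := d * (d \Po (- 'X)); set N := n * (d \Po (- 'X)).
have D_neq0 : D != 0 by rewrite mulf_neq0.
have DE : even_poly D \Po 'X^2 = D.
  apply/even_poly_comp/odd_poly_eq0; rewrite /D comp_polyM -comp_polyA.
  by rewrite raddfN /= comp_polyX opprK comp_polyXr mulrC.
have nd_ND : to_Qt n / to_Qt d = to_Qt N / to_Qt D.
  rewrite /N /D /to_Qt !tofracM -mulf_div divff ?mulr1 //.
  by rewrite tofrac_eq0.
have inL r : subfield_QX phi (to_Qt (r \Po 'X^2) / to_Qt D).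
  exists (r \Po quad_var alpha beta), (even_poly D \Po quad_var alpha beta).
  by rewrite !quad_phi_outer DE to_Qt_eq0.
pose q i := if i == ord0 :> 'I_2 then even_poly N else odd_poly N.
exists [ffun i => to_Qt (q i \Po 'X^2) / to_Qt D]; split.
  split=> [i|]; first by rewrite ffunE.
  rewrite big_ord_recl big_ord1 !ffunE /= /q /= mulr1 nd_ND.
  rewrite mulrAC -mulrDl; congr (_ / _).
  by rewrite /to_Qt -tofracM -tofracD poly_even_odd.
move=> k' [k'L sum_k']; apply/ffunP.
set k := [ffun i => _] in sum_k' *.
have kL i : subfield_QX phi (k i) by rewrite ffunE.
have sum_k : to_Qt n / to_Qt d = k ord0 + k (lift ord0 ord0) * to_Qt 'X.
  rewrite !ffunE /= /q /= nd_ND mulrAC -mulrDl; congr (_ / _).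
  by rewrite /to_Qt -tofracM -tofracD poly_even_odd.
have : (k ord0 - k' ord0) + (k (lift ord0 ord0) - k' (lift ord0 ord0)) * to_Qt 'X = 0.
  rewrite mulrBl addrACA -sum_k sum_k' big_ord_recl big_ord1 /= mulr1 -opprD.
  by rewrite subrr.
have subL i : subfield_QX phi (k i - k' i).
  exact: (subfield_QXB (kL i) (k'L i)).
case/(quad_independent (subL _) (subL _)) => /eqP.
rewrite subr_eq0 => /eqP k0 /eqP; rewrite subr_eq0 => /eqP k1.
by move=> i; have [j ->|->] := unliftP ord0 i; rewrite ?(ord1 j).
Qed.

(** On a graph, [c + t E(t^2)] would be a polynomial in [quad_X], hence even in [t]; independence of
    [1] and [Y - c] would then give [1 = 0]. *)
Lemma quad_not_graph (f g : {poly rat}) : ~ graph_component f g P.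
Proof.
move=> [h [dvd_h _ _]].
have /eqP := (quad_eqn_kernel beta c alpha_neq0 E_neq0 _).2 dvd_h.
rewrite rmorphB curve_paramY curve_param_outer => /eqP eq0.
have [|_ /eqP] := @quad_param_normal_eq0 _ alpha beta E alpha_neq0 E_neq0 (c%:P - h) 1.
  rewrite comp_polyB !comp_polyC mul1r -[RHS]eq0 /quad_Y.
  by ring.
by rewrite oner_eq0.
Qed.

(** Along the parametrization [U E(U)^2] and [(Y - c)^2] agree, hence so do their images under
    [G]. *)
Lemma quad_is_component (G : {poly rat}) :
  is_component (G \Po quad_rhs alpha beta E) (G \Po ('X - c%:P) ^+ 2) P.
Proof.
split; first exact: quad_eqn_prime.
apply/quad_eqn_kernel => //; rewrite /curve_eqn rmorphB.
have /eqP := quad_eqn_param beta c E alpha_neq0.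
rewrite /quad_eqn !rmorphB !curve_param_outer !curve_param_inner subr_eq0.
by rewrite -!comp_polyA => /eqP ->; rewrite subrr.
Qed.

Lemma quad_active :
  has_integer_value (alpha *: 'X^2 + beta%:P) -> active_for_integers P.
Proof.
exists phi, (quad_X alpha beta); split=> //; first exact: quad_affine_coordinate.
by rewrite /phi curve_fracE curve_paramX.
Qed.

End QuadraticFunctionField.

(** * Even compositions *)

(** This subleading coefficient determines the shift [c] that removes the subleading term of [g]. *)
Lemma coef_XsubC_exp_pred (R : comNzRingType) (c : R) n :
  (('X - c%:P) ^+ n.+1)`_n = - (c *+ n.+1).
Proof.
elim: n => [|n IHn]; first by rewrite expr1 coefB coefX coefC sub0r.
have lead1 : (('X - c%:P) ^+ n.+1)`_n.+1 = 1.
  by have := monicP (monic_exp n.+1 (monicXsubC c)); rewrite lead_coefE size_exp_XsubC.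
rewrite exprSr mulrBr coefB coefMX coefMC /= IHn lead1 mul1r.
by rewrite [c *+ n.+2]mulrS opprD addrC.
Qed.

(** All products of [a + b] factors have the same top coefficient, so in a sum of such products
    these coefficients add up instead of cancelling. *)
Lemma coef_mul_exp_lead (R : idomainType) (p q : {poly R}) (m a b : nat) :
    size p = m.+1 -> size q = m.+1 -> lead_coef q = lead_coef p ->
  (p ^+ a * q ^+ b)`_((a + b) * m) = lead_coef p ^+ (a + b).
Proof.
move=> sp sq lqp.
have p0 : p != 0 by rewrite -size_poly_gt0 sp.
have q0 : q != 0 by rewrite -size_poly_gt0 sq.
have sz : (size (p ^+ a * q ^+ b)).-1 = ((a + b) * m)%N.
  rewrite size_mul ?expf_neq0 //.
  rewrite -(prednK (n := size (p ^+ a))) ?size_poly_gt0 ?expf_neq0 //.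
  rewrite -(prednK (n := size (q ^+ b))) ?size_poly_gt0 ?expf_neq0 //.
  by rewrite !size_exp sp sq addSn addnS /= mulnDl ![(m * _)%N]mulnC.
by rewrite -sz -lead_coefE lead_coefM !lead_coef_exp lqp exprD.
Qed.

(** For nonzero [l] the degree of [l(B)] is at most [(n - 2) deg B]; the extra 1 in the size is
    absorbed by [deg B >= 1]. *)
Lemma size_lower_comp (R : idomainType) (l B : {poly R}) (n : nat) :
  (size l <= n.-1)%N -> (1 < size B)%N ->
  (size (l \Po B) <= n.-1 * (size B).-1)%N.
Proof.
have [->|l0 le_ln B_gt1] := eqVneq l 0; first by rewrite comp_poly0 size_poly0.
apply: leq_trans (size_comp_poly_leq _ _) _.
have sl : (0 < size l)%N by rewrite size_poly_gt0.
apply: (@leq_trans (size l * (size B).-1)); last by rewrite leq_mul2r le_ln orbT.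
case: (size l) sl => // k _; rewrite /= mulSn -add1n leq_add2r.
by case: (size B) B_gt1.
Qed.

(* With c chosen so that g - lead_coef g (X - c)^n has degree at most n - 2, the
   difference of the leading terms lead_coef g (B - c)^n at t and -t has degree at
   least (n - 1) deg B unless it vanishes, and nothing can compensate it. *)
Lemma comp_poly_even_symmetry (g B : {poly rat}) : (1 < size g)%N ->
  (g \Po B) \Po (- 'X) = g \Po B ->
  exists c : rat,
    (B - c%:P) \Po (- 'X) = (-1) ^+ (size B).-1 *: (B - c%:P).
Proof.
move=> g_gt1 sym; have [B_le1|B_gt1] := leqP (size B) 1.
  exists B`_0; rewrite -(size1_polyC B_le1) subrr comp_poly0.
  by rewrite scaler0.
set m := (size B).-1; set e : rat := (-1) ^+ m.
(* Here [deg g = n + 1], so that [n] is the index of the subleading coefficient. *)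
pose n := (size g).-2.
have sg : size g = n.+2 by rewrite /n; case: (size g) g_gt1 => [|[]].
have lg0 : lead_coef g != 0 by rewrite lead_coef_eq0 -size_poly_gt0 sg.
(* Solves [g_n = - (n + 1) c lead_coef g], which matches the subleading terms of [g] and
   [lead_coef g (X - c)^(n+1)]. *)
pose c := - (g`_n / (lead_coef g *+ n.+1)); exists c.
set D := B - c%:P.
have sB : size B = m.+1 by rewrite /m; case: (size B) B_gt1.
have m_gt0 : (0 < m)%N by rewrite -ltnS -sB.
have sD : size D = m.+1.
  by rewrite size_polyDl ?sB // size_polyN (leq_ltn_trans (size_polyC_leq1 c)).
have [ee e0] : e * e = 1 /\ e != 0 by rewrite -expr2 sqrr_sign signr_eq0.
(* The sign gives [W] the leading coefficient of [D]; the claim becomes [W = D]. *)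
pose W := e *: (D \Po (- 'X)).
have sNX : size (- 'X : {poly rat}) = 2 by rewrite size_polyN size_polyX.
have sW : size W = m.+1 by rewrite size_scale // size_comp_poly2.
have lW : lead_coef W = lead_coef D.
  rewrite lead_coefZ lead_coef_comp ?sNX // sD /= lead_coefN lead_coefX.
  by rewrite mulrCA ee mulr1.
have DW : D \Po (- 'X) = e *: W by rewrite scalerA ee scale1r.
suff WD : W = D by rewrite DW WD.
pose l := g - lead_coef g *: ('X - c%:P) ^+ n.+1.
have sl : (size l <= n.+1.-1)%N.
  apply/leq_sizeP => j; rewrite leq_eqVlt => /predU1P[<-|lt_nj].
    rewrite coefB coefZ coef_XsubC_exp_pred /c mulNrn opprK -mulr_natr.
    rewrite -[lead_coef g *+ _]mulr_natr; apply/eqP; rewrite subr_eq0; apply/eqP.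
    have : n.+1%:R != 0 :> rat by rewrite pnatr_eq0.
    by move: (n.+1%:R) => k k0; field; rewrite lg0 k0.
  move: lt_nj; rewrite leq_eqVlt => /predU1P[<-|lt_nj].
    rewrite coefB coefZ; have := monicP (monic_exp n.+1 (monicXsubC c)).
    by rewrite lead_coefE size_exp_XsubC /= => ->; rewrite mulr1 lead_coefE sg subrr.
  rewrite coefB coefZ !nth_default ?mulr0 ?subr0 ?sg //.
  by rewrite size_exp_XsubC.
have gE : g = lead_coef g *: ('X - c%:P) ^+ n.+1 + l by rewrite addrC subrK.
have gB : g \Po B = lead_coef g *: D ^+ n.+1 + (l \Po B).
  rewrite [in LHS]gE comp_polyD comp_polyZ rmorphXn /= comp_polyB comp_polyX.
  by rewrite comp_polyC.
pose r := (l \Po B) \Po (- 'X) - (l \Po B).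
have sr : (size r <= n * m)%N.
  rewrite (leq_trans (size_polyD _ _)) // size_polyN geq_max size_comp_poly2 //.
  by rewrite andbb; apply: size_lower_comp.
have eqr : lead_coef g *: (D ^+ n.+1 - e ^+ n.+1 *: W ^+ n.+1) = r.
  move: sym; rewrite gB comp_polyD comp_polyZ rmorphXn /= DW exprZn.
  move/eqP; rewrite -subr_eq0 => /eqP sym0.
  apply/eqP; rewrite -subr_eq0 /r; apply/eqP; rewrite -[RHS]oppr0 -[in RHS]sym0.
  by rewrite scalerBr; ring.
have lD0 : lead_coef D != 0 by rewrite lead_coef_eq0 -size_poly_gt0 sD.
have en : e ^+ n.+1 = 1 \/ e ^+ n.+1 = -1.
  by rewrite -exprM -signr_odd; case: odd; [right|left].
(* For the sign -1 the powers add, so the coefficient of degree [(n + 1) m] is a nonzero double,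
   beyond the degree of [r]. *)
case: en => en; rewrite en in eqr; last first.
  have := congr1 (fun p : {poly rat} => p`_(n.+1 * m)) eqr.
  rewrite /= [r`__]nth_default; last by rewrite (leq_trans sr) // leq_mul2r leqnSn orbT.
  rewrite scaleN1r opprK coefZ coefD.
  have := coef_mul_exp_lead n.+1 0 sD sD erefl; rewrite addn0 mulr1 => ->.
  have := coef_mul_exp_lead n.+1 0 sW sW erefl; rewrite addn0 mulr1 => ->.
  rewrite lW -mulr2n => /eqP; rewrite mulf_eq0 (negPf lg0) /= mulrn_eq0 /=.
  by rewrite expf_eq0 (negPf lD0) andbF.
apply/eqP; rewrite eq_sym -subr_eq0; apply/negPn/negP => DW0.
(* Factor [D^(n+1) - W^(n+1) = (D - W) S]. The coefficient of [S] in degree [n m] is [n + 1] times a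
   nonzero power, so a nonzero [D - W] would make the product too large to equal [r]. *)
move: eqr; rewrite scale1r subrXX; set S := \sum_(i < _) _ => eqr.
have coefS : S`_(n * m) = lead_coef D ^+ n *+ n.+1.
  rewrite coef_sum (eq_bigr (fun=> lead_coef D ^+ n)) => [|i _].
    by rewrite sumr_const card_ord.
  have le_in : (i <= n)%N by rewrite -ltnS.
  have := coef_mul_exp_lead (n - i) i sD sW lW.
  by rewrite subnK.
have S_gt : (n * m < size S)%N.
  rewrite ltnNge; apply/negP => /leq_sizeP/(_ _ (leqnn _))/eqP.
  by rewrite coefS mulrn_eq0 /= expf_eq0 (negPf lD0) andbF.
have S0 : S != 0 by rewrite -size_poly_gt0 (leq_ltn_trans _ S_gt).
have : (size S <= size r)%N.
  rewrite -eqr size_scale // size_mul //.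
  move: DW0; rewrite -size_poly_gt0.
  by case: (size (D - W)) => // k _; rewrite leq_addl.
by rewrite leqNgt (leq_ltn_trans sr).
Qed.

Lemma quadratic_decomposition (f g B : {poly rat}) (alpha beta : rat) :
    alpha != 0 -> (1 < size g)%N ->
    f \Po quad_X alpha beta = g \Po B ->
    (forall h : {poly rat}, B <> h \Po 'X^2) ->
  exists (c : rat) (E G : {poly rat}),
    [/\ E != 0, (1 < size G)%N, f = G \Po quad_rhs alpha beta E
      & g = G \Po (('X - c%:P) ^+ 2)].
Proof.
move=> alpha0 g_gt1 fgB B_odd.
have NX2 : 'X^2 \Po (- 'X) = 'X^2 :> {poly rat}.
  by rewrite rmorphXn /= comp_polyX sqrrN.
have [|c] := comp_poly_even_symmetry (B := B) g_gt1.
  by rewrite -fgB quad_X_comp -!comp_polyA NX2.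
(* If [deg B] is even, then [B - c] is even and [B] is a polynomial in [t^2], which is excluded. *)
rewrite -signr_odd; set D := B - c%:P; case: odd; last first.
  rewrite scale1r => /odd_poly_eq0/even_poly_comp DE.
  case: (B_odd (even_poly D + c%:P)).
  by rewrite comp_polyD comp_polyC DE subrK.
rewrite scaleN1r => /even_poly_eq0 D_even.
pose E := odd_poly D.
have DE : D = (E \Po 'X^2) * 'X.
  by rewrite -[LHS]poly_even_odd D_even comp_poly0 add0r.
have E0 : E != 0.
  apply/eqP => E0; case: (B_odd c%:P); apply/eqP.
  by rewrite comp_polyC -subr_eq0 -/D DE E0 comp_poly0 mul0r.
(* Write [g(Z + c) = G(Z^2) + Z H(Z^2)]. Since [D^2 = q(t^2)], the even and odd parts of [g(B)] are
   given by [G(q)] and [H(q) E]; as [f(alpha t^2 + beta)] is even, [H(q) E = 0], and [H = 0] because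
   [q] is nonconstant. *)
pose g1 := g \Po ('X + c%:P).
pose G := even_poly g1; pose H := odd_poly g1; pose q := 'X * E ^+ 2.
have gE : g = g1 \Po ('X - c%:P) by rewrite comp_polyXaddC_K.
have D2 : 'X^2 \Po D = q \Po 'X^2.
  rewrite rmorphXn /= comp_polyX comp_polyM rmorphXn /= comp_polyX DE.
  by rewrite exprMn mulrC.
have gBE : g \Po B = ((G \Po q) \Po 'X^2) + (((H \Po q) * E) \Po 'X^2) * 'X.
  have -> : g \Po B = g1 \Po D.
    rewrite gE -!comp_polyA; congr (_ \Po _).
    by rewrite comp_polyB comp_polyX comp_polyC.
  rewrite -{1}[g1]poly_even_odd comp_polyD comp_polyM comp_polyX -!comp_polyA D2.
  by rewrite (comp_polyM (H \Po q) E) -mulrA -DE !comp_polyA.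
have [|/eqP + /eqP] := @even_odd_poly_eq0 _
    ((f \Po (alpha *: 'X + beta%:P)) - (G \Po q)) (- ((H \Po q) * E)).
  rewrite comp_polyB [(- _) \Po _]raddfN /= mulNr -addrA -opprD -gBE -fgB.
  by rewrite quad_X_comp comp_polyA subrr.
rewrite subr_eq0 oppr_eq0 mulf_eq0 (negPf E0) orbF => /eqP fG.
have q_gt1 : (1 < size q)%N.
  rewrite size_mul ?polyX_eq0 ?expf_neq0 // size_polyX add2n ltnS.
  by rewrite size_poly_gt0 expf_neq0.
rewrite comp_poly_eq0 // => /eqP H0.
have gG : g = G \Po (('X - c%:P) ^+ 2).
  rewrite gE -{1}[g1]poly_even_odd -/H H0 comp_poly0 mul0r addr0 -comp_polyA.
  by rewrite rmorphXn /= comp_polyX.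
exists c, E, G; split=> //.
  rewrite ltnNge; apply/negP => G_le1; move: g_gt1.
  by rewrite gG (size1_polyC G_le1) comp_polyC size_polyC; case: (_ != 0).
have -> : f = (f \Po (alpha *: 'X + beta%:P)) \Po quad_var alpha beta.
  rewrite -comp_polyA comp_polyD comp_polyZ comp_polyX comp_polyC /quad_var.
  by rewrite scalerA divff // scale1r subrK comp_polyXr.
by rewrite fG -comp_polyA comp_polyM rmorphXn /= comp_polyX.
Qed.

(** * Parametrization of a component of degree 2 *)

(** A nonconstant reduced denominator has a root in [algC], and it divides the denominator of every
    fraction representing [z]. The double negation is what the negative definition of [at_infinity]
    provides. *)
Lemma to_Qt_poly (z : Qt) :
  (forall a : algC, ~ ~ regular_at z (Some a)) -> exists p, z = to_Qt p.
Proof.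
have [n [d [d0 ->]]] := Qt_fraction z => reg.
pose m := gcdp n d.
have m0 : m != 0 by rewrite gcdp_eq0 negb_and d0 orbT.
pose n' := n %/ m; pose d' := d %/ m.
have nE : n = n' * m by rewrite divpK // dvdp_gcdl.
have dE : d = d' * m by rewrite divpK // dvdp_gcdr.
have d'0 : d' != 0 by apply: contraNneq d0; rewrite dE => ->; rewrite mul0r.
have cop : coprimep d' n' by rewrite coprimep_sym coprimep_div_gcd // d0 orbT.
have nd : to_Qt n / to_Qt d = to_Qt n' / to_Qt d'.
  rewrite /to_Qt nE dE !tofracM -mulf_div divff ?mulr1 //.
  by rewrite tofrac_eq0.
have [d'_const|d'_nconst] := eqVneq (size d') 1.
  have [c c0 d'E] := size_poly1P _ (introT eqP d'_const).
  exists (c^-1 *: n'); rewrite nd d'E; apply: (canLR (mulfK _)).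
    by rewrite to_Qt_eq0 polyC_eq0.
  by rewrite /to_Qt -tofracM mulrC mul_polyC scalerA divff // scale1r.
have [a rt] : exists a, root (map_poly (ratr : rat -> algC) d') a.
  by apply/closed_rootP; rewrite size_map_poly.
case: (reg a) => -[n1 [d1 [+ d1a]]].
rewrite nd => eqz.
have d10 : d1 != 0 by apply: contraNneq d1a => ->; rewrite rmorph0 horner0.
have eqn : n' * d1 = n1 * d'.
  apply/eqP; rewrite -tofrac_eq !tofracM -eqr_div ?tofrac_eq0 //.
  exact/eqP.
have dvd_d1 : d' %| d1 by rewrite -(Gauss_dvdpr _ cop) eqn dvdp_mulIr.
move: d1a; rewrite -[_ == 0]/(root _ a) (root_dvdp _ rt) //.
by rewrite dvdp_map.
Qed.

(** Ring morphisms from [rat] to a field are unique, so only the images of [X] and [Y] matter. *)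
Lemma rmorph_poly2_ext (K : fieldType) (phi psi : {rmorphism {poly {poly rat}} -> K}) :
  phi 'X = psi 'X -> phi 'Y = psi 'Y -> phi =1 psi.
Proof.
move=> eqX eqY u; elim/poly_ind: u => [|u p IHu]; first by rewrite !rmorph0.
rewrite !rmorphD !rmorphM /= IHu eqX; congr (_ + _).
elim/poly_ind: p => [|p a IHp]; first by rewrite !rmorph0.
rewrite !rmorphD !rmorphM /= IHp eqY; congr (_ + _).
have := fmorph_eq_rat (phi \o polyC \o polyC) a.
by have := fmorph_eq_rat (psi \o polyC \o polyC) a => /= -> ->.
Qed.

(** As no finite point is at infinity, [phi 'Y] is a polynomial in [t] too, and [phi] is a
    substitution. *)
Lemma affine_coordinate_param (P : {poly {poly rat}}) phi (A : {poly rat}) :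
  affine_coordinate P phi -> phi 'X = to_Qt A ->
  exists B, forall u, phi u = to_Qt (curve_param A B u).
Proof.
move=> [_ infE] phiX; have [a nreg|B phiY] := @to_Qt_poly (phi 'Y).
  have /infE // : at_infinity phi (Some a) by case.
exists B => u; rewrite -curve_fracE; apply: rmorph_poly2_ext.
  by rewrite curve_fracE curve_paramX.
by rewrite curve_fracE curve_paramY.
Qed.

(** * Graph components *)

Lemma outer_normal_form (F : fieldType) (h : {poly F}) (u : {poly {poly F}}) :
  exists w r, u = w * ('Y - h^:P) + r^:P.
Proof.
have mulY (w : {poly {poly F}}) (r : {poly F}) :
    (w * ('Y - h^:P) + r^:P) * 'Y = (w * 'Y + r^:P) * ('Y - h^:P) + (r * h)^:P.
  by rewrite rmorphM /=; ring.
elim/poly_ind: u => [|u p [w1 [r1 ->]]].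
  by exists 0, 0; rewrite rmorph0 mul0r addr0.
have [w2 [r2 ->]] : exists w r, p%:P = w * ('Y - h^:P) + r^:P.
  elim/poly_ind: p => [|p a [w [r IHp]]].
    by exists 0, 0; rewrite !rmorph0 mul0r addr0.
  exists (w * 'Y + r^:P), (r * h + a%:P).
  by rewrite rmorphD rmorphM /= IHp mulY (rmorphD _ _ a%:P) /= map_polyC addrA.
exists (w1 * 'X + w2), (r1 * 'X + r2).
by rewrite rmorphD rmorphM /= map_polyX; ring.
Qed.

Lemma outer_kernel (F : fieldType) (h : {poly F}) (u : {poly {poly F}}) :
  curve_param 'X h u = 0 -> divides ('Y - h^:P) u.
Proof.
have [w [r ->]] := outer_normal_form h u.
rewrite rmorphD rmorphM rmorphB curve_paramY !curve_param_outer !comp_polyXr.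
by rewrite subrr mulr0 add0r => ->; exists w; rewrite rmorph0 addr0.
Qed.

(** Write [Y - h = w P] and put [Y = h(X)]. If [w] vanished there, [Y - h] would divide [w] and [P]
    would be a unit; so [P] vanishes, which gives the reverse divisibility and [f = g(h)]. *)
Lemma graph_component_of_divides (f g h : {poly rat}) (P : {poly {poly rat}}) :
  is_component f g P -> divides P ('Y - h^:P) -> graph_component f g P.
Proof.
move=> [[_ P_nunit _] [w' fgE]] dvd_h; exists h.
have [w hE] := dvd_h.
pose ev := curve_param 'X h.
have ev_h : ev ('Y - h^:P) = 0.
  by rewrite rmorphB /ev curve_paramY curve_param_outer comp_polyXr subrr.
have h0 : 'Y - h^:P != 0.
  apply/eqP => /(congr1 (curve_param 0 'X))/eqP.
  rewrite rmorph0 rmorphB curve_paramY curve_param_outer comp_poly0r.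
  by rewrite polyXsubC_eq0.
have evP : ev P = 0.
  move: ev_h; rewrite hE rmorphM => /eqP; rewrite mulf_eq0 => /orP[|/eqP //].
  move/eqP/outer_kernel => [w1 w1E]; case/negP: P_nunit.
  apply/unitrP; exists w1; rewrite [P * _]mulrC; suff -> : w1 * P = 1 by [].
  by apply: (mulIf h0); rewrite mul1r {2}hE w1E mulrAC.
split=> //; first exact: outer_kernel.
have : ev (curve_eqn f g) = 0 by rewrite fgE rmorphM evP mulr0.
rewrite /curve_eqn rmorphB /ev curve_param_outer curve_param_inner comp_polyXr.
by move/eqP; rewrite subr_eq0 => /eqP.
Qed.

(** * Degree over [Q(X)] and degree of the parametrization *)

Lemma degree2_dependent (K : fieldType) (phi : {rmorphism {poly {poly rat}} -> K})
    (x0 x1 x2 : K) : has_degree_over (subfield_QX phi) 2 ->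
  exists c0 c1 c2 : K,
    [/\ subfield_QX phi c0, subfield_QX phi c1, subfield_QX phi c2,
        c0 * x0 + c1 * x1 + c2 * x2 = 0 & [|| c0 != 0, c1 != 0 | c2 != 0]].
Proof.
move=> [e spanE].
have coords x : exists p q, [/\ subfield_QX phi p, subfield_QX phi q
    & x = p * e ord0 + q * e (lift ord0 ord0)].
  have [c [[cL ->] _]] := spanE x; exists (c ord0), (c (lift ord0 ord0)).
  by split=> //; rewrite big_ord_recl big_ord1.
have [p0 [q0 [Lp0 Lq0 ->]]] := coords x0.
have [p1 [q1 [Lp1 Lq1 ->]]] := coords x1.
have [p2 [q2 [Lp2 Lq2 ->]]] := coords x2.
move: (e ord0) (e (lift ord0 ord0)) => e0 e1.
have L0 := subfield_QX0 phi; have L1 := subfield_QX1 phi.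
have LM := @subfield_QXM _ phi; have LB := @subfield_QXB _ phi.
have LN x : subfield_QX phi x -> subfield_QX phi (- x).
  by move=> Lx; rewrite -sub0r; apply: LB.
have [c2|c2n] := eqVneq (p0 * q1 - p1 * q0) 0; last first.
  (* The cross product of the coordinate columns is orthogonal to both. *)
  exists (p1 * q2 - p2 * q1), (p2 * q0 - p0 * q2), (p0 * q1 - p1 * q0).
  split; try by apply: LB; apply: LM.
    by ring.
  by rewrite c2n !orbT.
(* The first two columns are now proportional, so a relation between [x0] and [x1] is enough; its
   coefficients come from whichever row is nonzero. *)
have rel01 : p1 * (p0 * e0 + q0 * e1) - p0 * (p1 * e0 + q1 * e1) = 0.
  by rewrite -(mulr0 (- e1)) -c2; ring.
have [p0z|p0n] := eqVneq p0 0; last first.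
  exists p1, (- p0), 0; split=> //; try exact: LN.
    by rewrite mul0r addr0 mulNr.
  by rewrite oppr_eq0 p0n orbT.
have [p1z|p1n] := eqVneq p1 0; last first.
  exists p1, (- p0), 0; split=> //; try exact: LN.
    by rewrite mul0r addr0 mulNr.
  by rewrite p1n.
have [q0z|q0n] := eqVneq q0 0.
  by exists 1, 0, 0; split; rewrite ?oner_neq0 // p0z q0z !mul0r !addr0 mulr0.
exists q1, (- q0), 0; split=> //; try exact: LN.
  by rewrite p0z p1z !mul0r !add0r addr0 mulNr mulrCA subrr.
by rewrite oppr_eq0 q0n orbT.
Qed.

Lemma degree2_dependent_poly (K : fieldType)
    (phi : {rmorphism {poly {poly rat}} -> K})
    (x0 x1 x2 : K) : has_degree_over (subfield_QX phi) 2 ->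
  exists a0 a1 a2 : {poly rat},
    phi a0^:P * x0 + phi a1^:P * x1 + phi a2^:P * x2 = 0
    /\ [|| phi a0^:P != 0, phi a1^:P != 0 | phi a2^:P != 0].
Proof.
move=> /(degree2_dependent x0 x1 x2)[_ [_ [_ [[u0 [v0 [n0 ->]]] [u1 [v1 [n1 ->]]]
  [u2 [v2 [n2 ->]]]]]]] rel nz.
exists (u0 * v1 * v2), (u1 * v0 * v2), (u2 * v0 * v1).
rewrite !rmorphM /= !mulf_eq0 !invr_eq0 in nz *.
rewrite (negPf n0) (negPf n1) (negPf n2) !orbF in nz *; split=> //.
rewrite -(mulr0 (phi v0^:P * phi v1^:P * phi v2^:P)) -rel.
by field; rewrite n0 n1 n2.
Qed.

Lemma add_poly_distinct_sizes (R : nzRingType) (p q : {poly R}) :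
  (p != 0 -> q != 0 -> size p <> size q) -> p + q = 0 -> p = 0 /\ q = 0.
Proof.
move=> dist /eqP; rewrite addr_eq0 => /eqP pq.
have [q0|q0] := eqVneq q 0; first by rewrite pq q0 oppr0.
by case: dist => //; rewrite pq ?oppr_eq0 ?size_polyN.
Qed.

Lemma add3_poly_distinct_sizes (R : nzRingType) (p q r : {poly R}) :
    (p != 0 -> q != 0 -> size p <> size q) ->
    (p != 0 -> r != 0 -> size p <> size r) ->
    (q != 0 -> r != 0 -> size q <> size r) ->
  p + q + r = 0 -> [/\ p = 0, q = 0 & r = 0].
Proof.
move=> pq pr qr sum0.
have [p0|p0] := eqVneq p 0.
  by move: sum0; rewrite p0 add0r => /(add_poly_distinct_sizes qr)[-> ->].
have [q0|q0] := eqVneq q 0.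
  by move: sum0; rewrite q0 addr0 => /(add_poly_distinct_sizes pr)[-> ->].
have [] := @add_poly_distinct_sizes _ (p + q) r _ sum0.
  move=> _ r0; have := pq p0 q0; have := pr p0 r0; have := qr q0 r0.
  move=> qr' pr' pq'.
  have [lt|gt|//] := ltngtP (size p) (size q); first by rewrite addrC size_polyDl.
  by rewrite size_polyDl.
move=> pq0; have [p00 _] := add_poly_distinct_sizes pq pq0.
by rewrite p00 eqxx in p0.
Qed.

(** Degree 2 forces a nontrivial relation [a0(A) + a1(A) t + a2(A) t^2 = 0]. Unless [deg A] is 1 or
    2, its nonzero terms have distinct degrees and cannot cancel. *)
Lemma size_component_X (P : {poly {poly rat}}) (A B : {poly rat}) :
    is_function_field P (curve_frac A B) -> dX_eq P 2 ->
  (size A == 2) || (size A == 3).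
Proof.
move=> [kerphi genphi] [K [psi [[kerpsi _] deg2]]].
have [u [v [phiv tE]]] := genphi (to_Qt 'X).
(* The degree is known in another model [K] of the function field. With [t = u / v], the elements
   [v^2], [u v], [u^2] express [1, t, t^2] through polynomials in [X] and [Y], and the relation
   moves between models because both kernels are the multiples of [P]. *)
have [a0 [a1 [a2 [rel nz]]]] :=
  degree2_dependent_poly (psi (v ^+ 2)) (psi (u * v)) (psi (u ^+ 2)) deg2.
have nzE a : (psi a^:P != 0) = (a \Po A != 0).
  rewrite -to_Qt_eq0 -(curve_param_outer A B) -curve_fracE; congr (~~ _).
  by apply/eqP/eqP => [/kerpsi/kerphi|/kerphi/kerpsi].
rewrite !nzE in nz.
have : divides P (a0^:P * v ^+ 2 + a1^:P * (u * v) + a2^:P * u ^+ 2).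
  by apply/kerpsi; rewrite !(rmorphD psi) !(rmorphM psi (_^:P)).
move=> /kerphi/eqP; rewrite curve_fracE to_Qt_eq0 => /eqP rel_t.
have param_uv : curve_param A B u = 'X * curve_param A B v.
  apply/eqP; rewrite -tofrac_eq tofracM.
  rewrite -[X in X == _]/(curve_frac A B u) -[X in _ == _ * X]/(curve_frac A B v).
  by rewrite -[FracField.tofrac 'X]/(to_Qt 'X) tE divfK.
have v0 : curve_param A B v != 0 by rewrite -to_Qt_eq0.
have rel' : (a0 \Po A) * 'X^0 + (a1 \Po A) * 'X^1 + (a2 \Po A) * 'X^2 = 0.
  apply: (mulIf (expf_neq0 2 v0)); rewrite mul0r -[RHS]rel_t.
  rewrite !rmorphD !rmorphM ?rmorphXn param_uv !curve_param_outer.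
  by ring.
have size_term a i : (a \Po A) * 'X^i != 0 ->
    (size ((a \Po A) * 'X^i)).-1 = ((size a).-1 * (size A).-1 + i)%N.
  rewrite mulf_eq0 negb_or => /andP[aA0 _].
  rewrite size_mulXn // -size_comp_poly addnC.
  by move: aA0; rewrite -size_poly_gt0; case: (size _) => // k _; rewrite addSn.
have [//|] := boolP ((size A == 2) || (size A == 3)) => sA.
(* The degree of a nonzero [a(A) t^i] is congruent to [i] modulo [deg A], which separates 0, 1, 2
   when [deg A >= 3]. For constant [A] the modulus is 0 and [modn] by 0 is the identity, so the
   argument still works. *)
have dist a b i j : (i < j < 3)%N -> (a \Po A) * 'X^i != 0 -> (b \Po A) * 'X^j != 0 ->
    size ((a \Po A) * 'X^i) <> size ((b \Po A) * 'X^j).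
  move=> ij ta tb /(congr1 predn).
  rewrite !size_term // => /(congr1 (modn^~ (size A).-1)).
  rewrite !modnMDl; case: (size A) sA ij => [|[|[|[|k]]]] // _ /andP[lt_ij lt_j3].
  - by move=> /= e; rewrite !modn0 in e; rewrite e ltnn in lt_ij.
  - by move=> /= e; rewrite !modn0 in e; rewrite e ltnn in lt_ij.
  rewrite /= !modn_small ?(leq_trans lt_j3) ?(leq_trans (ltn_trans lt_ij lt_j3)) //.
  by move=> e; rewrite e ltnn in lt_ij.
have [] := add3_poly_distinct_sizes (dist _ _ _ _ _) (dist _ _ _ _ _)
  (dist _ _ _ _ _) rel' => //.
have mulX0 p i : p * 'X^i = 0 -> p = 0 :> {poly rat}.
  by move/eqP; rewrite mulf_eq0 expf_eq0 polyX_eq0 andbF orbF => /eqP.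
move=> /mulX0 t0 /mulX0 t1 /mulX0 t2.
by rewrite t0 t1 t2 eqxx in nz.
Qed.

Lemma quadratic_component (f g : {poly rat}) (P : {poly {poly rat}}) :
    is_component f g P -> ~ graph_component f g P -> dX_eq P 2 ->
    active_for_integers P ->
  exists (alpha beta : rat) (B : {poly rat}),
    [/\ alpha != 0, has_integer_value (quad_X alpha beta),
        f \Po quad_X alpha beta = g \Po B
      & forall h : {poly rat}, B <> h \Po 'X^2].
Proof.
move=> compP ngraph dXP [phi [A [affP phiX [t [n At]]]]].
have [B phiE] := affine_coordinate_param affP phiX.
have [kerphi genphi] := affP.1.
have ker u : curve_param A B u = 0 <-> divides P u.
  rewrite -kerphi phiE; split=> [->|/eqP]; first exact: tofrac0.
  by rewrite to_Qt_eq0 => /eqP.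
have ffP : is_function_field P (curve_frac A B).
  split=> [u|z]; first by rewrite curve_fracE -phiE.
  by have [u [v]] := genphi z; rewrite !phiE; exists u, v.
have fgAB : f \Po A = g \Po B.
  have /ker := compP.2; rewrite rmorphB curve_param_outer curve_param_inner.
  by move/eqP; rewrite subr_eq0 => /eqP.
have ngraphB h : B <> h \Po A.
  move=> Bh; apply: ngraph; apply: (@graph_component_of_divides f g h) => //.
  by apply/ker; rewrite rmorphB curve_paramY curve_param_outer Bh subrr.
have sA : size A = 3.
  (* If [A] had degree 1, then [t] and hence [B] would be polynomials in [A]: a graph. *)
  case/orP: (size_component_X ffP dXP) => /eqP // sA.
  pose a := A`_1; have a0 : a != 0.
    have : lead_coef A != 0 by rewrite lead_coef_eq0 -size_poly_gt0 sA.
    by rewrite lead_coefE sA.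
  case: (ngraphB (B \Po (a^-1 *: ('X - (A`_0)%:P)))).
  have AE : A = a *: 'X + (A`_0)%:P.
    apply/polyP => i; rewrite coefD coefZ coefX coefC.
    by case: i => [|[|i]]; rewrite /= ?mulr0 ?add0r ?mulr1 ?addr0 // nth_default ?sA.
  rewrite -comp_polyA comp_polyZ comp_polyB comp_polyX comp_polyC {1}AE addrK.
  by rewrite scalerA mulVf // scale1r comp_polyXr.
pose alpha := A`_2; have alpha0 : alpha != 0.
  have : lead_coef A != 0 by rewrite lead_coef_eq0 -size_poly_gt0 sA.
  by rewrite lead_coefE sA.
(* Completing the square: the translation [t + e] is rational, so it preserves the set of values at
   rational points. *)
pose e := A`_1 / (2 * alpha); pose beta := A`_0 - alpha * e ^+ 2.
have AE : A = quad_X alpha beta \Po ('X + e%:P).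
  rewrite comp_polyD comp_polyZ rmorphXn /= comp_polyX comp_polyC.
  have -> : alpha *: ('X + e%:P) ^+ 2 + beta%:P =
      alpha *: 'X^2 + (2 * alpha * e) *: 'X + (alpha * e ^+ 2 + beta)%:P.
    rewrite -!mul_polyC !(rmorphD, rmorphM, rmorphXn) /=.
    by ring.
  have -> : 2 * alpha * e = A`_1 by rewrite /e; field.
  have -> : alpha * e ^+ 2 + beta = A`_0 by rewrite addrC subrK.
  apply/polyP => i; rewrite !coefD !coefZ coefX coefXn coefC.
  by case: i => [|[|[|i]]];
     rewrite /= ?mulr0 ?add0r ?mulr1 ?addr0 // nth_default ?sA.
have quadE : quad_X alpha beta = A \Po ('X - e%:P) by rewrite AE comp_polyXaddC_K.
exists alpha, beta, (B \Po ('X - e%:P)); split=> //.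
- exists (t + e), n; rewrite quadE horner_comp hornerXsubC addrK.
  exact: At.
- by rewrite quadE comp_polyA fgAB -comp_polyA.
(* If the translated [B] were [h(t^2)], then [B = h(U(A))], again a graph. *)
move=> h Bh; apply: (ngraphB (h \Po quad_var alpha beta)).
rewrite {1}AE comp_polyA -(comp_polyA h) quad_var_comp // -Bh.
by rewrite -comp_polyA comp_polyB comp_polyX comp_polyC addrK comp_polyXr.
Qed.

Theorem corollary8p10 :
  (forall (alpha beta : rat) (b d s : int),
     alpha != 0 -> quadratic_data alpha beta b d s ->
     (has_integer_value (alpha *: 'X^2 + beta%:P) <->
      exists z : int, (s * z ^+ 2 = - b %[mod d])%Z))
  /\
  (forall g : {poly rat}, (1 < size g)%N ->
   forall f : {poly rat},
     (exists P : {poly {poly rat}},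
        [/\ is_component f g P, rational_one_infinity P,
            ~ graph_component f g P, dX_eq P 2 & active_for_integers P])
     <->
     (exists (alpha beta c : rat) (E G : {poly rat}),
        [/\ alpha != 0, E != 0, (1 < size G)%N &
            let U := alpha^-1 *: ('X - beta%:P) in
            [/\ f = G \Po (U * (E \Po U) ^+ 2),
                g = G \Po (('X - c%:P) ^+ 2) &
                exists b d s : int,
                  quadratic_data alpha beta b d s /\
                  exists z : int, (s * z ^+ 2 = - b %[mod d])%Z]])).
Proof.
split=> [alpha beta b d s _|g g_gt1 f]; first exact: has_integer_value_quadratic.
split=> [[P [compP _ ngraph dXP actP]]|].
  have [alpha [beta [B [alpha0 intA fgB B_odd]]]] :=
    quadratic_component compP ngraph dXP actP.
  have [c [E [G [E0 G_gt1 fE gE]]]] := quadratic_decomposition alpha0 g_gt1 fgB B_odd.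
  exists alpha, beta, c, E, G; split=> //; split=> //.
  have [b [d [s data]]] := quadratic_data_exists beta alpha0.
  by exists b, d, s; split=> //; apply/(has_integer_value_quadratic data).
move=> [alpha [beta [c [E [G [alpha0 E0 _ [-> -> [b [d [s [data solv]]]]]]]]]]].
exists (quad_eqn alpha beta c E); split.
- exact: quad_is_component.
- exact: quad_rational_one_infinity.
- exact: quad_not_graph.
- exact: quad_dX.
- apply: quad_active => //.
  exact/(has_integer_value_quadratic data).
Qed.
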